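(* If $x=\sum_{i=0}^7x_i\mathbf{e}_i\in\mathbb{O}$ with $x_0,\ldots,x_7\in\mathbb{R}$, then for all $i=0,1,\ldots,7$, $$x_i=\frac{1}{8}\,\mathbf{e}_i\Big(\sum_{j=0}^7(-1)^{\sigma(j,i)}J_j(x)\Big).$$
   Context: $\mathbb{O}$ is the (non-associative) real octonion algebra with basis $\mathbf{e}_0=1,\mathbf{e}_1,\ldots,\mathbf{e}_7$, where $\mathbf{e}_i\mathbf{e}_j+\mathbf{e}_j\mathbf{e}_i=-2\delta_{ij}$ for $1\le i,j\le 7$, and $\mathbf{e}_i\mathbf{e}_j=\mathbf{e}_k$ whenever $(i,j,k)$ is a cyclic permutation of one of $(1,2,3),(1,4,5),(1,7,6),(2,5,7),(2,4,6),(3,4,7),(3,6,5)$. Conjugation is $\overline{x_0+\sum_{i\ge1}x_i\mathbf{e}_i}=x_0-\sum_{i\ge1}x_i\mathbf{e}_i$ for real $x_i$. For $i\in\{0,\ldots,7\}$ write $i=4i_3+2i_2+i_1$ with $i_1,i_2,i_3\in\{0,1\}$. $J_i$ is the algebra automorphism of $\mathbb{O}$ determined by $J_i(\mathbf{e}_1)=(-1)^{i_1}\mathbf{e}_1$, $J_i(\mathbf{e}_2)=(-1)^{i_2}\mathbf{e}_2$, $J_i(\mathbf{e}_4)=(-1)^{i_3}\mathbf{e}_4$ (these elements generate $\mathbb{O}$). The signs $\sigma(j,i)\in\{0,1\}$ are defined by $J_j(\overline{\mathbf{e}_i})=(-1)^{\sigma(j,i)}\mathbf{e}_i$ for $i,j=0,\ldots,7$.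 *)

(* Defs.v *)
From HB Require Import structures.
From mathcomp Require Import all_boot all_order all_algebra.
From mathcomp Require Import reals.

Set Implicit Arguments.
Unset Strict Implicit.
Unset Printing Implicit Defensive.

Import Order.TTheory GRing.Theory Num.Theory.

Local Open Scope ring_scope.

Notation octonion R := 'rV[R]_8.

(* The seven oriented lines of the Fano plane: (a, b, c) encodes e_a e_b = e_c
   together with its cyclic rotations. *)
Definition fano : seq (seq nat) :=
  [:: [:: 1; 2; 3]; [:: 1; 4; 5]; [:: 1; 7; 6]; [:: 2; 5; 7];
      [:: 2; 4; 6]; [:: 3; 4; 7]; [:: 3; 6; 5]]%N.

Definition cyclic_triple (i j k : nat) : bool :=
  has (fun t => [:: i; j; k] \in [:: t; rot 1 t; rot 2 t]) fano.

Section Octonions.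
Variable R : realType.
Implicit Types x y : octonion R.

(* Indexed by nat so that e_1, e_2, e_4 need no ordinal casts; only n < 8 is
   meaningful (oe n = 0 otherwise). *)
Definition oe (n : nat) : octonion R := \row_(j < 8) (j == n :> nat)%:R.

(* e_i e_j.  In the last case exactly one k contributes: +e_k if (i, j, k) is
   cyclic, -e_k if (j, i, k) is, as e_i e_j = - e_j e_i for i <> j. *)
Definition oe_mul (i j : nat) : octonion R :=
  if i == 0%N then oe j
  else if j == 0%N then oe i
  else if i == j then - oe 0
  else \sum_(k < 8)
         ((cyclic_triple i j k)%:R - (cyclic_triple j i k)%:R) *: oe k.

Definition omul x y : octonion R :=
  \sum_(i < 8) \sum_(j < 8) (x 0 i * y 0 j) *: oe_mul i j.

Definition oconj x : octonion R :=
  \row_(i < 8) (if i == 0 then x 0 i else - x 0 i).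

Definition oreal (c : R) : octonion R := c *: oe 0.

Definition octonion_automorphism (f : octonion R -> octonion R) : Prop :=
  [/\ linear f, bijective f, f (oe 0) = oe 0
    & forall x y, f (omul x y) = omul (f x) (f y)].

Definition is_J (i : 'I_8) (f : octonion R -> octonion R) : Prop :=
  octonion_automorphism f /\
  forall i1 i2 i3 : bool, i = (4 * i3 + 2 * i2 + i1)%N :> nat ->
    [/\ f (oe 1) = (-1) ^+ i1 *: oe 1,
        f (oe 2) = (-1) ^+ i2 *: oe 2
      & f (oe 4) = (-1) ^+ i3 *: oe 4].


(* Sanity checks: the product is bilinear with the expected multiplication
   table, and is_J determines a unique map, which exists, as do the signs. *)

Lemma octonion_sum x : x = \sum_(i < 8) x 0 i *: oe i.
Proof.
apply/rowP => j; rewrite summxE (bigD1 j) //= big1 => [|i ij].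
  by rewrite !mxE eqxx mulr1 addr0.
by rewrite !mxE eq_sym (negbTE ij : (i == j :> nat) = false) mulr0.
Qed.

Lemma omul_linearl y : linear (omul^~ y).
Proof.
move=> a u v; rewrite /omul scaler_sumr -big_split; apply: eq_bigr => i _ /=.
rewrite scaler_sumr -big_split; apply: eq_bigr => j _ /=.
by rewrite !mxE mulrDl scalerDl -mulrA scalerA.
Qed.

Lemma omul_linearr x : linear (omul x).
Proof.
move=> a u v; rewrite /omul scaler_sumr -big_split; apply: eq_bigr => i _ /=.
rewrite scaler_sumr -big_split; apply: eq_bigr => j _ /=.
by rewrite !mxE mulrDr scalerDl mulrCA scalerA.
Qed.

Lemma omul_oe (i j : 'I_8) : omul (oe i) (oe j) = oe_mul i j.
Proof.
rewrite /omul (bigD1 i) //= [X in _ + X]big1 => [|k ki]; last first.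
  by apply: big1 => l _; rewrite mxE (negbTE ki : (k == i :> nat) = false)
    mul0r scale0r.
rewrite addr0 (bigD1 j) //= big1 => [|l lj].
  by rewrite !mxE !eqxx mulr1 scale1r addr0.
by rewrite !mxE (negbTE lj : (l == j :> nat) = false) mulr0 scale0r.
Qed.

Lemma omul_oe0l x : omul (oe 0) x = x.
Proof.
rewrite [RHS]octonion_sum /omul big_ord_recl /= [X in _ + X]big1 => [|k _].
  by rewrite addr0; apply: eq_bigr => j _; rewrite mxE mul1r.
by apply: big1 => j _; rewrite !mxE mul0r scale0r.
Qed.

Lemma oe_anticomm (i j : 'I_8) : i != 0 -> j != 0 ->
  omul (oe i) (oe j) + omul (oe j) (oe i) = (- (2 * (i == j)%:R)) *: oe 0.
Proof.
move=> i0 j0; rewrite !omul_oe /oe_mul.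
rewrite (negbTE i0 : (i == 0 :> nat)%N = false).
rewrite (negbTE j0 : (j == 0 :> nat)%N = false) [j == i :> nat]eq_sym.
rewrite -[(i == j)%R]/(i == j :> nat); case: ifP => _.
  by rewrite mulr1 scaleNr scaler_nat mulr2n opprD.
rewrite mulr0 oppr0 scale0r -big_split big1 //= => k _.
by rewrite -scalerDl addrC subrKA subrr scale0r.
Qed.

Local Lemma cycE : all (fun i => all (fun j => all (fun k =>
    cyclic_triple i j k ==> [&& i != 0, j != 0, i != j &
      all (fun l => (cyclic_triple i j l == (l == k)) && ~~ cyclic_triple j i l)
        (iota 0 8)]) (iota 0 8)) (iota 0 8)) (iota 0 8)%N.
Proof. by vm_compute. Qed.

Lemma omul_cyclic (i j k : 'I_8) :
  cyclic_triple i j k -> omul (oe i) (oe j) = oe k.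
Proof.
have I8 (l : 'I_8) : nat_of_ord l \in iota 0 8 by rewrite mem_iota ltn_ord.
have /implyP h := allP (allP (allP cycE _ (I8 i)) _ (I8 j)) _ (I8 k).
move=> /h /and4P[i0 j0 ij] /allP hl; rewrite omul_oe /oe_mul.
rewrite (negbTE i0) (negbTE j0) (negbTE ij) (bigD1 k) //= big1 => [|l lk].
  have /andP[/eqP-> /negbTE->] := hl _ (I8 k).
  by rewrite eqxx subr0 scale1r addr0.
have /andP[/eqP-> /negbTE->] := hl _ (I8 l).
by rewrite (negbTE lk : (l == k :> nat) = false) subr0 scale0r.
Qed.

(* Parity of the common binary digits: J_j e_i = (-1)^(chi j i) e_i. *)
Local Definition chi (j i : nat) : bool :=
  (odd j && odd i) (+) (odd j./2 && odd i./2) (+) (odd (j %/ 4) && odd (i %/ 4)).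

Local Definition sgn (j : nat) x : octonion R := \row_(i < 8) ((-1) ^+ chi j i * x 0 i).

Local Lemma sgn_oe j (i : nat) : sgn j (oe i) = (-1) ^+ chi j i *: oe i.
Proof.
apply/rowP => k; rewrite !mxE; case: eqP => [->//|_]; by rewrite !mulr0.
Qed.

Local Lemma sgn_linear j : linear (sgn j).
Proof. by move=> a u v; apply/rowP => k; rewrite !mxE mulrDr mulrCA. Qed.

Local Lemma sgnZ j a x : sgn j (a *: x) = a *: sgn j x.
Proof. by apply/rowP => k; rewrite !mxE mulrCA. Qed.

Local Lemma sgn_sum j (F : 'I_8 -> octonion R) :
  sgn j (\sum_i F i) = \sum_i sgn j (F i).
Proof.
apply/rowP => k; rewrite !mxE !summxE mulr_sumr.
by apply: eq_bigr => i _; rewrite mxE.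
Qed.

Local Lemma cyc_chi : all (fun d => all (fun i => all (fun j => all (fun k =>
    cyclic_triple i j k ==> (chi d k == chi d i (+) chi d j))
  (iota 0 8)) (iota 0 8)) (iota 0 8)) (iota 0 8)%N.
Proof. by vm_compute. Qed.

Local Lemma sgn_oe_mul (d i j : 'I_8) :
  sgn d (oe_mul i j) = (-1) ^+ (chi d i (+) chi d j) *: oe_mul i j.
Proof.
have I8 (l : 'I_8) : nat_of_ord l \in iota 0 8 by rewrite mem_iota ltn_ord.
have chi0 : chi d 0 = false by rewrite /chi !andbF.
have cycchi (a b c : 'I_8) : cyclic_triple a b c ->
    chi d c = chi d a (+) chi d b.
  have /implyP h :=
    allP (allP (allP (allP cyc_chi _ (I8 d)) _ (I8 a)) _ (I8 b)) _ (I8 c).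
  by move=> /h /eqP.
rewrite /oe_mul; case: eqP => [->|_]; first by rewrite sgn_oe chi0.
case: eqP => [->|_]; first by rewrite sgn_oe chi0 addbF.
case: eqP => [<-|_].
  rewrite addbb scale1r; apply/rowP => k; rewrite !mxE.
  by case: eqP => [->|_]; rewrite ?chi0 ?mul1r // oppr0 mulr0.
apply/rowP => k; rewrite !mxE !summxE !mulr_sumr; apply: eq_bigr => l _.
rewrite !mxE; case: eqP => [/ord_inj->|_]; last by rewrite !mulr0.
case hij: (cyclic_triple i j l); first by rewrite (cycchi _ _ _ hij).
case hji: (cyclic_triple j i l); first by rewrite (cycchi _ _ _ hji) addbC.
by rewrite subr0 mul0r !mulr0.
Qed.

Local Lemma sgn_is_J (d : 'I_8) : is_J d (sgn d).
Proof.
have sgnK : involutive (sgn d).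
  by move=> x; apply/rowP => k; rewrite !mxE mulrA -signr_addb addbb mul1r.
split; first split.
- exact: sgn_linear.
- exact: (inv_bij sgnK).
- by rewrite sgn_oe /chi !andbF scale1r.
- move=> x y; rewrite /omul.
  rewrite sgn_sum; apply: eq_bigr => i _; rewrite sgn_sum.
  apply: eq_bigr => j _; rewrite sgnZ sgn_oe_mul !mxE scalerA.
  by congr (_ *: _); rewrite signr_addb mulrC mulrACA.
move=> i1 i2 i3 di; rewrite !sgn_oe di.
by split; congr (_ ^+ nat_of_bool _ *: _); rewrite /chi;
  case: i1 i2 i3 {di} => [] [] [].
Qed.

Lemma is_J_exists (i : 'I_8) : exists f, is_J i f.
Proof. by exists (sgn i); exact: sgn_is_J. Qed.

Lemma is_J_unique (i : 'I_8) f g : is_J i f -> is_J i g -> f =1 g.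
Proof.
have lin_ext (h : octonion R -> octonion R) x : linear h -> h x = \sum_(k < 8) x 0 k *: h (oe k).
  move=> hl; pose m := GRing.isLinear.Build _ _ _ _ _ hl.
  pose H : {linear octonion R -> octonion R} := HB.pack h m.
  rewrite {1}[x]octonion_sum -[h]/(H : _ -> _) linear_sum.
  by apply: eq_bigr => k _; rewrite linearZ.
have [b1 [b2 [b3 ib]]] : exists b1 b2 b3 : bool,
    i = (4 * b3 + 2 * b2 + b1)%N :> nat.
  exists (odd i), (odd i./2), (odd (i %/ 4)).
  by case: i; do 8?[case=> //].
case=> [[fl _ f0 fM] /(_ _ _ _ ib) [f1 f2 f4]].
case=> [[gl _ g0 gM] /(_ _ _ _ ib) [g1 g2 g4]] x.
have cyc (a b c : 'I_8) : cyclic_triple a b c ->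
    f (oe a) = g (oe a) -> f (oe b) = g (oe b) -> f (oe c) = g (oe c).
  by move=> /omul_cyclic <- fa fb; rewrite fM gM fa fb.
have E0 : f (oe 0) = g (oe 0) by rewrite f0.
have E1 : f (oe 1) = g (oe 1) by rewrite f1.
have E2 : f (oe 2) = g (oe 2) by rewrite f2.
have E4 : f (oe 4) = g (oe 4) by rewrite f4.
have E3 := cyc (@Ordinal 8 1 isT) (@Ordinal 8 2 isT) (@Ordinal 8 3 isT)
  isT E1 E2.
have E5 := cyc (@Ordinal 8 1 isT) (@Ordinal 8 4 isT) (@Ordinal 8 5 isT)
  isT E1 E4.
have E6 := cyc (@Ordinal 8 2 isT) (@Ordinal 8 4 isT) (@Ordinal 8 6 isT)
  isT E2 E4.
have E7 := cyc (@Ordinal 8 3 isT) (@Ordinal 8 4 isT) (@Ordinal 8 7 isT)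
  isT E3 E4.
rewrite (lin_ext f) // (lin_ext g) //; apply: eq_bigr => k _; congr (_ *: _).
by case: k; do 8?[case=> //].
Qed.

Lemma sigma_exists (J : 'I_8 -> octonion R -> octonion R) :
  (forall i, is_J i (J i)) ->
  exists sigma : 'I_8 -> 'I_8 -> bool,
    forall i j : 'I_8, J j (oconj (oe i)) = (-1) ^+ sigma j i *: oe i.
Proof.
move=> hJ; exists (fun j i : 'I_8 => (i != 0) (+) chi j i) => i j.
rewrite (is_J_unique (hJ j) (sgn_is_J j)); apply/rowP => k; rewrite !mxE.
case: (k =P i :> nat) => [/ord_inj->|_]; last by rewrite oppr0 if_same !mulr0.
by rewrite signr_addb; case: (i == 0); rewrite ?mul1r //= mulrN mulN1r mulNr.
Qed.

End Octonions.

(* Main.v *)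
(* Each J_j acts diagonally, by e_k |-> (-1)^(chi j k) e_k, where the sign is a
   character of (Z/2)^3 in j. Orthogonality of the eight characters leaves only
   the i-th coordinate in the signed sum of the J_j x, and left
   multiplication by e_i turns it into a real number, since
   e_i (conj e_i) = 1. *)

Require Import Defs.
From HB Require Import structures.
From mathcomp Require Import all_boot all_order all_algebra.
From mathcomp Require Import reals.

Set Implicit Arguments.
Unset Strict Implicit.
Unset Printing Implicit Defensive.

Import Order.TTheory GRing.Theory Num.Theory.

Local Open Scope ring_scope.

(** Writing each sign as [(-1) ^+ b = 1 - 2b] reduces the sum to counting the [j] at which the
    characters of [i] and [k] differ. *)
Lemma chi_orthogonal (S : pzRingType) (i k : 'I_8) :
  \sum_(j < 8) (-1) ^+ Defs.chi j i * (-1) ^+ Defs.chi j k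
    = 8 * (i == k)%:R :> S.
Proof.
under eq_bigr => j _ do rewrite -signr_addb.
have signE (b : bool) : (-1) ^+ b = 1 - b.*2%:R :> S.
  by case: b; rewrite ?subr0 // opprD addrA subrr sub0r.
under eq_bigr => j _ do rewrite signE.
rewrite sumrB -natr_sum sumr_const card_ord -natrM.
(* Distinct characters differ at exactly four of the eight [j]; this is checked over all pairs [i],
   [k]. *)
have -> : (\sum_(j < 8) (Defs.chi j i (+) Defs.chi j k).*2 = 8 * (i != k))%N.
  rewrite !big_ord_recl big_ord0 -[i != k]/(i != k :> nat).
  by case: i k; do 8?[case=> //] => ? []; do 8?[case=> //].
by case: (i == k); rewrite ?muln1 ?muln0 ?subr0 ?subrr.
Qed.

(** By uniqueness, [f] is the explicit diagonal map [sgn j]. *)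
Lemma is_J_coord (R : realType) (j : 'I_8) f (x : octonion R) (k : 'I_8) :
  is_J j f -> f x 0 k = (-1) ^+ Defs.chi j k * x 0 k.
Proof. by move=> fJ; rewrite (is_J_unique fJ (Defs.sgn_is_J R j)) mxE. Qed.

Lemma omulZr (R : realType) (a : R) (x y : octonion R) :
  omul x (a *: y) = a *: omul x y.
Proof.
have omulx0 : omul x 0 = 0.
  by rewrite /omul big1 // => i _; rewrite big1 // => j _;
    rewrite mxE mulr0 scale0r.
by rewrite -[a *: y]addr0 omul_linearr omulx0 addr0.
Qed.

Lemma oe_sqr (R : realType) (i : 'I_8) :
  omul (oe R i) (oe R i) = (-1) ^+ (i != 0) *: oe R 0.
Proof.
rewrite omul_oe /oe_mul eqxx -[i != 0]/(i != 0 :> nat)%N.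
by case: (i =P 0 :> nat)%N => [->|_]; rewrite ?scale1r ?scaleN1r.
Qed.

Theorem lemma3p1 (R : realType)
    (J : 'I_8 -> octonion R -> octonion R)
    (hJ : forall i : 'I_8, is_J i (J i))
    (sigma : 'I_8 -> 'I_8 -> bool)
    (hsigma : forall i j : 'I_8,
       J j (oconj (oe R i)) = (-1) ^+ sigma j i *: oe R i)
    (x : octonion R) (x_ : 'I_8 -> R)
    (hx : x = \sum_(i < 8) x_ i *: oe R i)
    (i : 'I_8) :
  oreal (x_ i) =
    8%:R^-1 *: omul (oe R i) (\sum_(j < 8) (-1) ^+ sigma j i *: J j x).
Proof.
have xE k : x 0 k = x_ k.
  rewrite hx summxE (bigD1 k) //= big1 => [|l lk].
    by rewrite !mxE eqxx mulr1 addr0.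
  by rewrite !mxE eq_sym (negbTE lk : (l == k :> nat) = false) mulr0.
(* Compare [i]-th coordinates in [hsigma]: conjugation gives the first sign, [J j] the second. *)
have sigmaE j : (-1) ^+ sigma j i = (-1) ^+ (i != 0) * (-1) ^+ Defs.chi j i :> R.
  have /rowP/(_ i) := hsigma i j.
  rewrite (is_J_coord _ _ (hJ j)) !mxE eqxx mulr1 mulrC => <-.
  by case: (i == 0).
have -> : \sum_(j < 8) (-1) ^+ sigma j i *: J j x
    = (8 * (-1) ^+ (i != 0) * x_ i) *: oe R i.
  apply/rowP => k; rewrite summxE !mxE.
  under eq_bigr => j _ do
    rewrite mxE (is_J_coord _ _ (hJ j)) sigmaE mulrA -[X in X * _]mulrA.
  rewrite -mulr_suml -mulr_sumr chi_orthogonal xE [i == k]eq_sym.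
  rewrite -[(k == i :> nat)]/(k == i).
  case: (k =P i) => [->|_]; last by rewrite !mulr0 mul0r.
  by rewrite !mulr1 [8 * _]mulrC.
(* The sign [(-1) ^+ (i != 0)] now occurs twice, from conjugation and from the square of [oe R i],
   and cancels. *)
rewrite omulZr oe_sqr !scalerA /oreal; congr (_ *: _).
rewrite !mulrA mulVf ?pnatr_eq0 // mul1r mulrAC -signr_addb addbb.
by rewrite mul1r.
Qed.
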